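(* Let $F$ be a face of $\mathcal P_\Phi$ of dimension $1$. Then the roots in $F$ form a string with $2$ or $3$ roots: if $\gamma$ and $\gamma'$ are the vertices of $F$, then either (1) $\gamma$ and $\gamma'$ are not perpendicular, there are no other roots in $F$, and $\gamma-\gamma'$ is a root; or (2) $\gamma$ and $\gamma'$ are perpendicular, there is only a third root $\gamma''$ in $F$ ($\gamma''$ short), and $\gamma-\gamma''=\gamma''-\gamma'$ is a root (so that $\gamma-\gamma'$ is twice a root).
   Context: $\Phi$ is a finite irreducible reduced crystallographic root system in the Euclidean space $\mathrm{Span}_{\mathbb R}\Phi$ with scalar product $(\cdot,\cdot)$; its elements are called roots. $\mathcal P_\Phi$ is the convex hull of $\Phi$. For roots $\alpha,\beta$, the $\alpha$-string through $\beta$ is $(\beta+\mathbb Z\alpha)\cap\Phi$; ''the roots in $F$ form a string'' means that $F\cap\Phi$ is the $\beta$-string through one of its elements, for some $\beta\in\Phi$. If $\Phi$ has roots of two different lengths, the short roots are those of smaller length; if all roots have the same length, they are all regarded as long. *)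

(* Defs.v *)
From HB Require Import structures.
From mathcomp Require Import all_boot all_order all_algebra.
From mathcomp Require Import finmap.
From mathcomp Require Import boolp classical_sets reals.

Set Implicit Arguments.
Unset Strict Implicit.
Unset Printing Implicit Defensive.

Import Order.TTheory GRing.Theory Num.Theory.

Local Open Scope ring_scope.
Local Open Scope classical_set_scope.

Section RootPolytope.
Variables (R : realType) (V : vectType R) (dot : {dot V for idfun}).
Implicit Types (Phi A B : {fset V}) (K F : set V).

Definition cartan_number (beta alpha : V) : R :=
  2 * dot beta alpha / dot alpha alpha.

(* The ambient Euclidean space is the span of the roots. *)
Record crystallographic_root_system Phi : Prop := {
  roots_span : <<enum_fset Phi>>%VS = fullv;
  root_neq0 : 0 \notin Phi;
  root_reflection : forall alpha beta, alpha \in Phi -> beta \in Phi ->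
    beta - cartan_number beta alpha *: alpha \in Phi;
  root_integral : forall alpha beta, alpha \in Phi -> beta \in Phi ->
    exists k : int, cartan_number beta alpha = k%:~R
}.

Definition reduced Phi : Prop :=
  forall (alpha : V) (c : R), alpha \in Phi -> c *: alpha \in Phi ->
    c = 1 \/ c = -1.

Definition irreducible Phi : Prop :=
  Phi <> fset0 /\
  forall A B, Phi = (A `|` B)%fset ->
    (forall a b, a \in A -> b \in B -> dot a b = 0) ->
    A = fset0 \/ B = fset0.

(* "Smaller length" only makes sense when there is more than one length:
   in the simply laced case no root is short. *)
Definition short_root Phi (gamma : V) : Prop :=
  [/\ gamma \in Phi,
      exists2 beta, beta \in Phi & dot beta beta != dot gamma gamma
    & forall beta, beta \in Phi -> dot gamma gamma <= dot beta beta].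

Definition root_string Phi (alpha beta : V) : {fset V} :=
  [fset x in Phi | `[< exists k : int, x = (beta + alpha *~ k)%R >]]%fset.

Definition convex_hull (S : {fset V}) : set V :=
  [set x | exists w : V -> R,
     [/\ forall a, a \in S -> 0 <= w a,
         \sum_(a <- S) w a = 1
       & x = \sum_(a <- S) w a *: a]].

(* Faces are cut out by genuine supporting hyperplanes (u != 0); hence a
   full-dimensional polytope is not one of its own faces. *)
Definition face K F : Prop :=
  exists (u : V) (c : R),
    [/\ u != 0, forall x, K x -> dot u x <= c
      & F = [set x | K x /\ dot u x = c]].

(* U is the direction of the affine hull of F. *)
Definition has_dim F (d : nat) : Prop :=
  F !=set0 /\
  exists U : {vspace V},
    [/\ \dim U = d,
        forall x y, F x -> F y -> x - y \in U
      & forall W : {vspace V},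
          (forall x y, F x -> F y -> x - y \in W) -> (U <= W)%VS].

Definition vertices F : set V := [set v | face F [set v]].

Definition roots_in Phi F : {fset V} := [fset x in Phi | `[< F x >]]%fset.

End RootPolytope.

(* Main.v *)
(* If g and g' are roots of the edge F, supported by (u, .) = c with c > 0, then
   (g, g') >= 0, since otherwise g + g' would be a root where (u, .) is 2c. When
   g and g' are the ends of F and (g, g') > 0, the difference g - g' is a root;
   an inner root x would make g - x another root parallel to it, contradicting
   reducedness. When (g, g') = 0, irreducibility gives a root y orthogonal to
   neither end, and after reflections (g, y) > 0 > (g', y). Then g - y and g' +
   y are roots on which (u, .) sums to 2c, so both lie on F, and F has an inner
   root x. Now g - x and x - g' are parallel roots, hence equal, so x is the
   only inner root. The reflections of g and g' in x have (u, .) at least -c,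
   which forces |g|^2 = |g'|^2 = 2|x|^2; as squared lengths of roots differ by a
   factor less than 4, and at least 2 when distinct, no root is shorter than x. *)
Require Import Defs.
From mathcomp Require Import all_boot all_order all_algebra.
From mathcomp Require Import finmap.
From mathcomp Require Import boolp classical_sets reals.
From mathcomp Require Import zify ring lra.

Set Implicit Arguments.
Unset Strict Implicit.
Unset Printing Implicit Defensive.

Import Order.TTheory GRing.Theory Num.Theory.

Local Open Scope ring_scope.
Local Open Scope classical_set_scope.

(** * Bilinearity and positivity of the scalar product *)

Section InnerProduct.
Variables (R : realType) (V : vectType R) (dot : {dot V for idfun}).
Implicit Types (x y z : V) (a : R).

Lemma dotC x y : dot x y = dot y x.
Proof. by rewrite hermC /= expr0 mul1r. Qed.

Lemma dotDr x y z : dot x (y + z) = dot x y + dot x z.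
Proof. exact: linearDr. Qed.

Lemma dotNr x y : dot x (- y) = - dot x y.
Proof. exact: linearNr. Qed.

Lemma dotZr a x y : dot x (a *: y) = a * dot x y.
Proof. exact: linearZr_LR. Qed.

Lemma dotDl x y z : dot (y + z) x = dot y x + dot z x.
Proof. by rewrite dotC dotDr !(dotC x). Qed.

Lemma dotNl x y : dot (- y) x = - dot y x.
Proof. by rewrite dotC dotNr dotC. Qed.

Lemma dotZl a x y : dot (a *: x) y = a * dot x y.
Proof. by rewrite dotC dotZr dotC. Qed.

Definition dotE := (dotDl, dotDr, dotNl, dotNr, dotZl, dotZr).

Lemma dot_sumr (I : Type) (r : seq I) (f : I -> V) x :
  dot x (\sum_(i <- r) f i) = \sum_(i <- r) dot x (f i).
Proof. exact: linear_sumr. Qed.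

Lemma dot_gt0 x : x != 0 -> 0 < dot x x.
Proof. exact: neq0_dnorm_gt0. Qed.

Lemma dot0l x : dot 0 x = 0.
Proof. by rewrite -(scale0r 0) dotZl mul0r. Qed.

Lemma dot0r x : dot x 0 = 0.
Proof. by rewrite dotC dot0l. Qed.

Lemma dot_eq0 x : dot x x = 0 -> x = 0.
Proof.
move=> xx0; apply/eqP; apply: contraT => /dot_gt0.
by rewrite xx0 ltxx.
Qed.

Lemma dot_ge0 x : 0 <= dot x x.
Proof. by have [->|/dot_gt0/ltW//] := eqVneq x 0; rewrite dot0l. Qed.

End InnerProduct.

(** * Cartan integers, irreducibility and root lengths *)

Section Roots.
Variables (R : realType) (V : vectType R) (dot : {dot V for idfun}).
Variable (Phi : {fset V}).
Hypothesis rootsP : crystallographic_root_system dot Phi.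
Implicit Types (a b x y : V).

Lemma root_gt0 a : a \in Phi -> 0 < dot a a.
Proof.
move=> aP; apply: dot_gt0; apply: contraTneq aP => ->.
exact: root_neq0 rootsP.
Qed.

Lemma root_opp a : a \in Phi -> - a \in Phi.
Proof.
move=> aP; have := root_reflection rootsP aP aP.
rewrite /cartan_number mulfK ?gt_eqF ?root_gt0//.
by rewrite scaler_nat mulr2n opprD addNKr.
Qed.

Lemma cartanP a b : a \in Phi -> b \in Phi ->
  exists2 k : int, 2 * dot b a = k%:~R * dot a a & b - k%:~R *: a \in Phi.
Proof.
move=> aP bP; have [k kE] := root_integral rootsP aP bP.
exists k; last by rewrite -kE; apply: root_reflection rootsP _ _ _ _.
by rewrite -kE /cartan_number divfK// gt_eqF ?root_gt0.
Qed.

Lemma eq_of_dot_eq a b :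
  dot a b = dot a a -> dot a b = dot b b -> a = b.
Proof.
move=> aE bE; apply/eqP; rewrite -subr_eq0; apply/eqP.
by apply: (@dot_eq0 _ _ dot); rewrite !dotE (dotC dot b a); lra.
Qed.

(* Cauchy-Schwarz: [m * n] is 4 cos^2 of the angle between [a] and [b]. *)
Lemma cartan_mul_le4 a b (m n : int) : a \in Phi -> b \in Phi ->
  2 * dot a b = m%:~R * dot b b -> 2 * dot a b = n%:~R * dot a a -> m * n <= 4.
Proof.
move=> aP bP mE nE; have a0 := root_gt0 aP; have b0 := root_gt0 bP.
rewrite -(ler_int R) intrM.
(* This squared norm equals [(4 - m * n) * dot a a]. *)
have := dot_ge0 dot (2 *: a - m%:~R *: b).
rewrite !dotE (dotC dot b a).
rewrite -(ler_pM2r a0) -mulrA (_ : n%:~R * _ = 2 * dot a b)//.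
nra.
Qed.

(** Both Cartan integers are positive with product at most 4. If one of them is 1, the corresponding
    reflection gives [a - b] or its negative; otherwise both are 2, which forces [a = b]. *)
Lemma root_sub a b : a \in Phi -> b \in Phi -> a != b -> 0 < dot a b ->
  a - b \in Phi.
Proof.
move=> aP bP aNb ab0; have a0 := root_gt0 aP; have b0 := root_gt0 bP.
have [m mE am] := cartanP bP aP; have [n nE bn] := cartanP aP bP.
rewrite dotC in nE.
have := cartan_mul_le4 aP bP mE nE.
have m0 : 0 < m by rewrite -(ltr0z R); nra.
have n0 : 0 < n by rewrite -(ltr0z R); nra.
move=> mn.
have [m1|[n1|[m2 n2]]] : m = 1 \/ n = 1 \/ m = 2 /\ n = 2 by nia.
- by rewrite m1 scale1r in am.
- by rewrite n1 scale1r in bn; rewrite -opprB root_opp.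
- case/eqP: aNb; apply: eq_of_dot_eq; move: mE nE.
  + by rewrite n2; lra.
  + by rewrite m2; lra.
Qed.

Hypothesis Phi_irr : irreducible dot Phi.
Hypothesis Phi_red : reduced Phi.

(** The roots sharing a neighbor with [b] form a set [B] orthogonal to its complement, so
    irreducibility makes [B] all of [Phi]. *)
Lemma common_neighbor a b : a \in Phi -> b \in Phi ->
  exists2 y, y \in Phi & dot a y != 0 /\ dot b y != 0.
Proof.
move=> aP bP.
pose near x := exists2 y, y \in Phi & dot x y != 0 /\ dot b y != 0.
pose B := [fset x in Phi | `[< near x >]]%fset.
have inB x : x \in B = (x \in Phi) && `[< near x >] by rewrite !inE.
have bB : b \in B.
  rewrite inB bP; apply/asboolP; exists b => //.
  by rewrite gt_eqF ?root_gt0.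
have PAB : Phi = (B `|` (Phi `\` B))%fset.
  apply/fsetP => x; rewrite in_fsetU in_fsetD inB.
  by case: (x \in Phi) => //=; case: asboolP.
have BA z x : z \in B -> x \in (Phi `\` B)%fset -> dot z x = 0.
  rewrite in_fsetD !inB => /andP[zP /asboolP[y yP [zy byn]]] /andP[xB xP].
  apply/eqP; apply: contraNT xB => zx; rewrite xP; apply/asboolP.
  (* Being non-orthogonal to [z], the root [x] joins [B] through one of three witnesses: [z], [y],
     or the reflection of [y] in [z]. *)
  have [bz|bz] := eqVneq (dot b z) 0; last by exists z => //; rewrite dotC.
  have [xy|xy] := eqVneq (dot x y) 0; last by exists y.
  have [k kE sP] := cartanP zP yP.
  have k0 : k%:~R != 0 :> R.
    by apply: contraNneq zy => k0; rewrite dotC; apply/eqP; rewrite k0 in kE; lra.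
  exists (y - k%:~R *: z) => //; rewrite !dotE xy bz (dotC dot x z); split.
    by rewrite add0r oppr_eq0 mulf_neq0.
  by rewrite mulr0 subr0.
have [B0|A0] := Phi_irr.2 _ _ PAB BA; first by rewrite B0 inE in bB.
have : a \in B by apply: contraT => aB; rewrite -(in_fset0 a) -A0 inE aB.
by rewrite inB => /andP[_ /asboolP].
Qed.

(** Serves to compare lengths through Cartan integers, which say nothing about orthogonal roots. If
    [b] is orthogonal to [a], its reflection in a common neighbor is not. *)
Lemma isometric_root_acute a b : a \in Phi -> b \in Phi ->
  exists2 s, s \in Phi & dot s s = dot b b /\ 0 < dot a s.
Proof.
move=> aP bP.
suff [s sP [ss a_s]] : exists2 s, s \in Phi & dot s s = dot b b /\ dot a s != 0.
  have [a_s0|a_s0|/eqP] := ltrgt0P (dot a s); last by rewrite (negPf a_s).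
    by exists s.
  by exists (- s); rewrite ?root_opp// !dotE opprK oppr_gt0.
have [ab|ab] := eqVneq (dot a b) 0; last by exists b.
have [y yP [ay byn]] := common_neighbor aP bP.
have [k kE sP] := cartanP yP bP.
have k0 : k%:~R != 0 :> R.
  by apply: contraNneq byn => k0; apply/eqP; rewrite k0 in kE; lra.
exists (b - k%:~R *: y) => //; rewrite !dotE ab; split.
  by have := congr1 ( *%R k%:~R) kE; rewrite (dotC dot y b); lra.
by rewrite add0r oppr_eq0 mulf_neq0.
Qed.

(** With [b] replaced by [s], the smaller Cartan integer [n] is 1, so [m] is the ratio of the
    squared lengths. It is 2 or 3, since 4 would mean [a = 2 *: s], against reducedness. *)
Lemma longer_root_bounds a b : a \in Phi -> b \in Phi -> dot b b < dot a a ->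
  2 * dot b b <= dot a a < 4 * dot b b.
Proof.
move=> aP /(isometric_root_acute aP)[s sP [<- a_s]] sa.
have a0 := root_gt0 aP; have s0 := root_gt0 sP.
have [m mE am] := cartanP sP aP; have [n nE bn] := cartanP aP sP.
rewrite dotC in nE.
have mn := cartan_mul_le4 aP sP mE nE.
have n0 : 0 < n by rewrite -(ltr0z R); nra.
have ltnm : n < m by rewrite -(ltr_int R) -(ltr_pM2r s0) -mE nE ltr_pM2l ?ltr0z.
have n1 : n = 1 by nia.
rewrite n1 in nE.
have [m2|[m3|m4]] : m = 2 \/ m = 3 \/ m = 4 by nia.
- by rewrite m2 in mE; lra.
- by rewrite m3 in mE; lra.
rewrite m4 in mE.
have a2s : a = 2 *: s by apply: (@eq_of_dot_eq _ (2 *: s)); rewrite !dotE; lra.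
have := Phi_red (c := 2) sP; rewrite -a2s => /(_ aP)[]; lra.
Qed.

(** * Roots on an edge whose ends are roots *)

Section Edge.
Variables (u : V) (c : R) (g g' : V).
Hypothesis c_gt0 : 0 < c.
Hypothesis u_le : forall a, a \in Phi -> dot u a <= c.
Hypotheses (gP : g \in Phi) (g'P : g' \in Phi) (gNg' : g != g').
Hypotheses (ug : dot u g = c) (ug' : dot u g' = c).
Hypothesis edge_segment : forall a, a \in Phi -> dot u a = c ->
  exists2 t : R, 0 <= t <= 1 & a = g' + t *: (g - g').

Lemma edge_dot_ge0 a b : a \in Phi -> b \in Phi ->
  dot u a = c -> dot u b = c -> 0 <= dot a b.
Proof.
move=> aP bP ua ub; rewrite leNgt; apply/negP => ab.
suff /u_le : a - - b \in Phi by rewrite !dotE ua ub opprK gerDl leNgt c_gt0.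
apply: root_sub; rewrite ?root_opp// ?dotE ?oppr_gt0//.
apply: contra_eq_neq ua => ->.
by rewrite dotNr ub lt_eqF// (lt_trans _ c_gt0)// oppr_lt0.
Qed.

Lemma edge_inner_root a : a \in Phi -> dot u a = c -> a != g -> a != g' ->
  exists2 t : R, 0 < t < 1 & a = g' + t *: (g - g').
Proof.
move=> aP /(edge_segment aP)[t t01 aE] aNg aNg'; exists t => //.
have t0 : t != 0 by apply: contraNneq aNg' => t0; rewrite aE t0 scale0r addr0.
have t1 : t != 1 by apply: contraNneq aNg => t1; rewrite aE t1 scale1r subrKC.
by rewrite !lt_neqAle (eq_sym 0) t0 t1.
Qed.

Lemma edge_acute : 0 < dot g g' ->
  g - g' \in Phi /\
  forall a, a \in Phi -> dot u a = c -> a = g \/ a = g'.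
Proof.
move=> gg'; have dP : g - g' \in Phi by apply: root_sub.
split=> // a aP ua; have [->|aNg] := eqVneq a g; first by left.
have [->|aNg'] := eqVneq a g'; first by right.
have [t t01 aE] := edge_inner_root aP ua aNg aNg'.
have gaE : g - a = (1 - t) *: (g - g').
  by rewrite aE scalerBl scale1r opprD addrA.
have : g - a \in Phi.
  apply: root_sub => //; first by rewrite eq_sym.
  by rewrite aE !dotE; have := root_gt0 gP; nra.
by rewrite gaE => /(Phi_red dP)[] ?; exfalso; lra.
Qed.

Lemma edge_orthogonal_inner : dot g g' = 0 ->
  exists2 x, x \in Phi & [/\ dot u x = c, x != g & x != g'].
Proof.
move=> gg'; have c0 := c_gt0.
have g0 := root_gt0 gP; have g'0 := root_gt0 g'P.
have [y yP [gy g'y]] : exists2 y, y \in Phi & 0 < dot g y /\ dot g' y < 0.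
  have [z zP [gz g'z]] : exists2 y, y \in Phi & 0 < dot g y /\ dot g' y != 0.
    have [y yP [gy g'y]] := common_neighbor gP g'P.
    have [gy0|gy0|/eqP] := ltrgt0P (dot g y); last by rewrite (negPf gy).
      by exists y.
    by exists (- y); rewrite ?root_opp// !dotE oppr_gt0 oppr_eq0.
  have [g'z0|g'z0|/eqP] := ltrgt0P (dot g' z); last by rewrite (negPf g'z).
    (* Reflection in [g'] flips the sign of [dot g' z] and, as [g] and [g'] are orthogonal, keeps
       [dot g z]. *)
    have [k kE sP] := cartanP g'P zP.
    exists (z - k%:~R *: g') => //; rewrite !dotE gg'; split; first by lra.
    by move: kE; rewrite (dotC dot z g'); lra.
  by exists z.
have xP : g - y \in Phi.
  apply: root_sub => //; apply: contraTneq g'y => <-.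
  by rewrite dotC gg' ltxx.
have zP : g' - - y \in Phi.
  apply: root_sub; rewrite ?root_opp ?dotE ?oppr_gt0//.
  apply: contraTneq gy => /eqP; rewrite -eqr_oppLR => /eqP <-.
  by rewrite dotE gg' oppr0 ltxx.
have ux := u_le xP; have uz := u_le zP.
(* The bound at [g - y] gives [0 <= dot u y]; the bound at [g' + y] gives the opposite
   inequality. *)
have uy : dot u y = 0 by move: ux uz; rewrite !dotE ug ug'; lra.
exists (g - y) => //; split.
- by rewrite !dotE uy subr0.
- rewrite -subr_eq0 addrAC subrr add0r oppr_eq0.
  by apply: contraTneq gy => ->; rewrite dot0r ltxx.
(* If g - y = g', reflecting y in g' gives the root g + g', where (u, .) is 2c. *)
- apply/eqP => xE; have yE : y = g - g' by rewrite -xE opprB subrKC.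
  have [k kE] := cartanP g'P yP.
  have k2 : k%:~R = -2 :> R.
    apply: (mulIf (lt0r_neq0 g'0)); rewrite -kE yE !dotE gg'; lra.
  by rewrite k2 => /u_le; rewrite !dotE uy ug'; lra.
Qed.

Lemma edge_orthogonal x : dot g g' = 0 -> x \in Phi -> dot u x = c ->
  x != g -> x != g' ->
  [/\ short_root dot Phi x, g - x = x - g', g - x \in Phi
    & forall a, a \in Phi -> dot u a = c -> [\/ a = g, a = g' | a = x]].
Proof.
move=> gg' xP ux xNg xNg'; have c0 := c_gt0.
have g0 := root_gt0 gP; have g'0 := root_gt0 g'P; have x0 := root_gt0 xP.
(* The roots [g - a] and [a - g'] are parallel with ratio [(1 - t) / t]. Reducedness makes it 1 or
   -1, and -1 is impossible, so [a] is the midpoint. *)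
have subP a : a \in Phi -> dot u a = c -> a != g -> a != g' ->
    g - a \in Phi /\ a = g' + 2^-1 *: (g - g').
  move=> aP ua aNg aNg'.
  have [t t01 aE] := edge_inner_root aP ua aNg aNg'.
  have gaP : g - a \in Phi.
    apply: root_sub => //; first by rewrite eq_sym.
    by rewrite aE !dotE gg'; nra.
  have agP : a - g' \in Phi.
    by apply: root_sub => //; rewrite aE !dotE gg'; nra.
  split=> //; suff -> : 2^-1 = t by [].
  have t0 : t != 0 by lra.
  have gaE : g - a = ((1 - t) / t) *: (a - g').
    by rewrite aE addrAC subrr add0r scalerA divfK// scalerBl scale1r opprD addrA.
  rewrite gaE in gaP; have [/eqP|/eqP] := Phi_red agP gaP.
    by rewrite -subr_eq0 -[X in _ - X](divff t0) -mulrBl mulf_eq0 invr_eq0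
      (negPf t0) orbF => /eqP; lra.
  by rewrite -subr_eq0 -[X in _ - - X](divff t0) -mulNr -mulrBl mulf_eq0
    invr_eq0 (negPf t0) orbF => /eqP; lra.
have [gxP xE] := subP x xP ux xNg xNg'.
(* The negative of the reflection of [a] in [x] is a root on which [dot u] is [(k - 1) * c]. *)
have cartan_le2 a (k : int) : dot u a = c -> a - k%:~R *: x \in Phi -> k <= 2.
  move=> ua /root_opp/u_le; rewrite !dotE ua ux -(ler_int R) => ?.
  by rewrite -(ler_pM2r c_gt0); lra.
have [k kE /(cartan_le2 _ _ ug) k2] := cartanP xP gP.
have [k' k'E /(cartan_le2 _ _ ug') k'2] := cartanP xP g'P.
have gxE : 2 * dot g x = dot g g by rewrite xE !dotE gg'; lra.
have g'xE : 2 * dot g' x = dot g' g' by rewrite xE !dotE (dotC dot g' g) gg'; lra.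
have xxE : 4 * dot x x = dot g g + dot g' g'.
  by rewrite -gxE -g'xE {1}xE !dotE; lra.
(* As [x] is the midpoint of orthogonal ends, [k] and [k'] are the ratios of [dot g g] and
   [dot g' g'] to [dot x x], which add up to 4. Neither exceeds 2, so both are 2. *)
have kk' : k + k' = 4.
  apply: (@intr_inj R); rewrite intrD; apply: (mulIf (lt0r_neq0 x0)).
  by rewrite mulrDl -kE -k'E; lra.
have kE2 : k = 2 by move: k2 k'2 kk'; clear; lia.
have ggE : dot g g = 2 * dot x x by rewrite -gxE kE kE2.
split=> //.
- split=> //; first by exists g => //; rewrite gt_eqF//; lra.
  (* A root [b] shorter than [x] would have [4 * dot b b <= 2 * dot x x = dot g g], too large a
     ratio between [g] and [b]. *)
  move=> b bP; rewrite leNgt; apply/negP => bx.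
  have := longer_root_bounds xP bP bx.
  have : dot b b < dot g g by lra.
  by move/(longer_root_bounds gP bP); lra.
- rewrite {2}xE addrAC subrr add0r {1}xE opprD addrA -{1}[g - g']scale1r.
  by rewrite -scalerBl; congr (_ *: _); lra.
- move=> a aP ua; have [->|aNg] := eqVneq a g; first by constructor 1.
  have [->|aNg'] := eqVneq a g'; first by constructor 2.
  by constructor 3; rewrite xE; have [] := subP a aP ua aNg aNg'.
Qed.

End Edge.

End Roots.

(** * Convex hulls, supporting hyperplanes and segments *)

Section Hull.
Variables (R : realType) (V : vectType R) (dot : {dot V for idfun}).
Implicit Types (S : {fset V}) (F : set V) (a u x g : V).

Lemma sub_convex_hull S a : a \in S -> convex_hull S a.
Proof.
move=> aS; exists (fun b => (b == a)%:R); split.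
- by move=> b _; rewrite ler0n.
- rewrite (bigD1_seq a) ?fset_uniq//= eqxx big1 ?addr0//.
  by move=> b /negPf ->.
- rewrite (bigD1_seq a) ?fset_uniq//= eqxx scale1r big1 ?addr0//.
  by move=> b /negPf ->; rewrite scale0r.
Qed.

(* The weights of [x] vanish outside the supporting hyperplane. *)
Lemma face_dot_le S u (c : R) e (M : R) x :
  (forall a, a \in S -> dot u a <= c) ->
  convex_hull S x -> dot u x = c ->
  (forall a, a \in S -> dot u a = c -> dot e a <= M) -> dot e x <= M.
Proof.
move=> u_le [w [w0 w1 xE]] ux eM.
have ws0 : \sum_(a <- S) w a * (c - dot u a) = 0.
  under eq_bigr => a _ do rewrite mulrBr.
  rewrite sumrB -mulr_suml w1 mul1r -[X in X - _]ux xE dot_sumr.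
  by apply/eqP; rewrite subr_eq0; apply/eqP/eq_bigr => a _; rewrite dotZr.
have w_off a : a \in S -> w a = 0 \/ dot u a = c.
  move=> aS; have /eqP : w a * (c - dot u a) = 0.
    move: ws0; rewrite big_seq => /eqP; rewrite psumr_eq0; last first.
      by move=> b bS; rewrite mulr_ge0 ?w0// subr_ge0 u_le.
    by move=> /allP /(_ a aS); rewrite aS => /eqP.
  by rewrite mulf_eq0 subr_eq0 => /orP[]/eqP ->; [left|right].
rewrite xE dot_sumr -[M]mul1r -w1 mulr_suml !big_seq.
apply: ler_sum => a aS; rewrite dotZr.
have [->|ua] := w_off a aS; first by rewrite !mul0r.
by rewrite ler_wpM2l ?w0// eM.
Qed.

Lemma dot_span_eq0 S u : <<enum_fset S>>%VS = fullv ->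
  (forall a, a \in S -> dot u a = 0) -> u = 0.
Proof.
move=> Sfull u0; apply: (@dot_eq0 _ _ dot).
have /coord_span {2}-> : u \in <<in_tuple (enum_fset S)>>%VS.
  by rewrite Sfull memvf.
rewrite dot_sumr big1// => i _; rewrite dotZr u0 ?mulr0//.
by have : S`_i \in enum_fset S by exact: mem_nth.
Qed.

Lemma fset_argmax (S : {fset V}) (P : pred V) (f : V -> R) a0 :
  a0 \in S -> P a0 ->
  exists2 g, g \in S /\ P g & forall a, a \in S -> P a -> f a <= f g.
Proof.
move=> a0S Pa0.
case: (@Order.TotalTheory.arg_maxP _ _ S [` a0S]%fset (P \o val) (f \o val) Pa0).
move=> g Pg gmax; exists (val g); first by split=> //; exact: fsvalP.
by move=> a aS Pa; exact: (gmax [` aS]%fset).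
Qed.

(** The directions [g - g'] and [g' - g] expose the two ends. Conversely, a supporting hyperplane
    that meets the segment strictly inside contains both ends, so it does not cut out a single
    point. *)
Lemma segment_vertices F g g' : g != g' -> F g -> F g' ->
  (forall x, F x -> exists2 t : R, 0 <= t <= 1 & x = g' + t *: (g - g')) ->
  vertices dot F = [set g; g'].
Proof.
move=> gNg' Fg Fg' Fseg; have ee := dot_gt0 dot _; move: (ee (g - g')).
rewrite subr_eq0 => /(_ gNg') {}ee.
apply/seteqP; split=> v /=.
  move=> [u [c [u0 u_le vE]]].
  have [Fv uv] : F v /\ dot u v = c.
    by have : [set v] v by []; rewrite vE.
  have [t /andP[t0 t1] vt] := Fseg v Fv.
  have gv : F g -> dot u g = c -> g = v.
    by move=> ? ?; have : [set v] g by rewrite vE.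
  have g'v : F g' -> dot u g' = c -> g' = v.
    by move=> ? ?; have : [set v] g' by rewrite vE.
  have ug := u_le g Fg; have ug' := u_le g' Fg'.
  move: uv; rewrite vt !dotE => uv.
  have [t00|tN0] := eqVneq t 0; first by right; rewrite /= t00 scale0r addr0.
  left; have [t11|tN1] := eqVneq t 1; first by rewrite /= t11 scale1r subrKC.
  have {}t0 : 0 < t by rewrite lt_neqAle eq_sym tN0.
  have {}t1 : t < 1 by rewrite lt_neqAle tN1.
  have tg : 0 <= t * (c - dot u g) by rewrite mulr_ge0 ?subr_ge0// ltW.
  have tg' : 0 <= (1 - t) * (c - dot u g') by rewrite mulr_ge0 ?subr_ge0// ltW.
  have /eqP : t * (c - dot u g) = 0 by lra.
  have /eqP : (1 - t) * (c - dot u g') = 0 by lra.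
  rewrite !mulf_eq0 !subr_eq0 (gt_eqF t0) (gt_eqF t1) /=.
  move=> /eqP/esym/(g'v Fg') g'E /eqP/esym/(gv Fg) gE.
  by rewrite gE g'E eqxx in gNg'.
have dd : 0 < dot (g - g') g - dot (g - g') g'.
  by rewrite -dotNr -dotDr.
have eF x (t : R) : x = g' + t *: (g - g') ->
    dot (g - g') x = dot (g - g') g' + t * (dot (g - g') g - dot (g - g') g').
  by move=> ->; rewrite (dotDr dot (g - g')) dotZr (dotDr dot (g - g') g) dotNr.
case=> ->.
- exists (g - g'), (dot (g - g') g); split; first by rewrite subr_eq0.
    by move=> x /Fseg[t t01 /eF ->]; nra.
  apply/seteqP; split=> x /=; first by move->.
  move=> [/Fseg[t t01 xt]]; rewrite (eF _ _ xt) => tE.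
  have t1 : t = 1 by apply: (mulIf (lt0r_neq0 dd)); lra.
  by rewrite xt t1 scale1r subrKC.
- exists (g' - g), (dot (g' - g) g').
  have dN x : dot (g' - g) x = - dot (g - g') x by rewrite -dotNl opprB.
  split; first by rewrite subr_eq0 eq_sym.
    by move=> x /Fseg[t t01 /eF]; rewrite !dN => ->; nra.
  apply/seteqP; split=> x /=; first by move->.
  move=> [/Fseg[t t01 xt]]; rewrite !dN (eF _ _ xt) => tE.
  have t0 : t = 0 by apply: (mulIf (lt0r_neq0 dd)); lra.
  by rewrite xt t0 scale0r addr0.
Qed.

(** The ends are the extreme roots of [F] along its direction. They bound all of [F], because a
    linear bound on the roots of a face extends to the face. *)
Lemma face_segment (Phi : {fset V}) F :
  crystallographic_root_system dot Phi ->
  face dot (convex_hull Phi) F -> has_dim F 1 ->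
  exists u c g g',
    [/\ 0 < c, forall a, a \in Phi -> dot u a <= c,
        forall a, F a <-> convex_hull Phi a /\ dot u a = c,
        [/\ g \in Phi, g' \in Phi, F g, F g' & g != g']
      & forall x, F x -> exists2 t : R, 0 <= t <= 1 & x = g' + t *: (g - g')].
Proof.
move=> rootsP [u [c [uN0 uK FE]]] [[x0 Fx0] [U [dU UF UW]]].
have FP a : F a <-> convex_hull Phi a /\ dot u a = c by rewrite FE.
have u_le a : a \in Phi -> dot u a <= c by move=> /sub_convex_hull/uK.
(* If [c <= 0], the bounds at [a] and [- a] make [u] orthogonal to every root; the roots span, so
   [u = 0]. *)
have c0 : 0 < c.
  rewrite ltNge; apply: contra uN0 => c0; apply/eqP.
  apply: (dot_span_eq0 (roots_span rootsP)) => a aP.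
  have := u_le a aP; have := u_le _ (root_opp rootsP aP); rewrite dotNr.
  by move=> ? ?; apply/eqP; rewrite eq_le; apply/andP; split; lra.
have [a0 a0P ua0] : exists2 a, a \in Phi & dot u a = c.
  apply: contrapT => noroot.
  have [Kx0 ux0] := (FP x0).1 Fx0.
  (* Without roots on F, [face_dot_le] holds vacuously for any bound. *)
  suff : dot 0 x0 <= (-1 : R) by rewrite dot0l; lra.
  apply: (face_dot_le u_le Kx0 ux0) => a aP ua.
  by case: noroot; exists a.
pose e := vpick U.
have eN0 : e != 0 by rewrite vpick0 -dimv_eq0 dU.
have UE : U = <[e]>%VS.
  by apply/esym/eqP; rewrite eqEdim -memvE memv_pick dim_vline eN0 dU.
have ee := dot_gt0 dot eN0.
have Froot a : a \in Phi -> dot u a = c -> F a.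
  by move=> /sub_convex_hull ? ?; apply/FP.
have [g [gP /eqP ug] gmax] :=
  fset_argmax (P := fun a => dot u a == c) (dot e) a0P (introT eqP ua0).
have [g' [g'P /eqP ug'] g'max] :=
  fset_argmax (P := fun a => dot u a == c) (dot (- e)) a0P (introT eqP ua0).
have Fg := Froot _ gP ug; have Fg' := Froot _ g'P ug'.
have eg x : F x -> dot e x <= dot e g.
  move=> /FP[Kx ux]; apply: (face_dot_le u_le Kx ux) => a aP ua.
  by apply: gmax => //; apply/eqP.
have eg' x : F x -> dot e g' <= dot e x.
  move=> /FP[Kx ux]; rewrite -lerN2 -!dotNl.
  apply: (face_dot_le u_le Kx ux) => a aP ua.
  by apply: g'max => //; apply/eqP.
have FU x y : F x -> F y -> exists k, x - y = k *: e.
  by move=> Fx Fy; apply/vlineP; rewrite -UE UF.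
have dFU x y k : x - y = k *: e -> dot e x - dot e y = k * dot e e.
  by move=> xy; rewrite -dotZr -xy dotDr dotNr.
(* Otherwise [dot e] is constant on [F], so [F] is a point and the minimality of [U] makes [U]
   zero. *)
have gNg' : g != g'.
  apply/eqP => gg'; suff : (U <= 0)%VS by rewrite subv0 -dimv_eq0 dU.
  apply: UW => x y Fx Fy; rewrite memv0; have [k kE] := FU x y Fx Fy.
  suff k0 : k = 0 by rewrite kE k0 scale0r.
  have exy : dot e x = dot e y.
    have := eg _ Fx; have := eg _ Fy; have := eg' _ Fx; have := eg' _ Fy.
    by rewrite gg'; lra.
  move/dFU: kE; rewrite exy subrr => /esym/eqP.
  by rewrite mulf_eq0 (gt_eqF ee) orbF => /eqP.
exists u, c, g, g'; split=> // x Fx.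
have [k kE] := FU g g' Fg Fg'; have [k' k'E] := FU x g' Fx Fg'.
have k0 : k != 0.
  by apply: contraNneq gNg' => k0; rewrite -subr_eq0 kE k0 scale0r.
have {}k0 : 0 < k.
  rewrite lt_neqAle eq_sym k0 -(pmulr_lge0 _ ee) -(dFU _ _ _ kE).
  by rewrite subr_ge0 eg.
(* Measured from [g'] along [e], [x] has coordinate [k'] and [g] has coordinate [k]. *)
exists (k' / k); last by rewrite kE scalerA divfK ?gt_eqF// -k'E subrKC.
have := eg _ Fx; have := eg' _ Fx; have := dFU _ _ _ kE; have := dFU _ _ _ k'E.
move=> d1 d2 d3 d4; rewrite divr_ge0 ?(ltW k0)//=.
  by rewrite ler_pdivrMr// mul1r -(ler_pM2r ee); lra.
by rewrite -(pmulr_lge0 _ ee); lra.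
Qed.

End Hull.

(** * From the edge as a set to its finite set of roots *)

Section EdgeRoots.
Variables (R : realType) (V : vectType R) (dot : {dot V for idfun}).
Variables (Phi : {fset V}) (F : set V) (u : V) (c : R).
Hypothesis rootsP : crystallographic_root_system dot Phi.
Hypothesis FP : forall a, F a <-> convex_hull Phi a /\ dot u a = c.

Lemma in_roots_in a : a \in roots_in Phi F <-> a \in Phi /\ dot u a = c.
Proof.
rewrite !inE; split=> [/andP[aP /asboolP/FP[_ ua]]//|[aP ua]].
by rewrite aP; apply/asboolP/FP; split=> //; apply: sub_convex_hull.
Qed.

(** A string in a direction orthogonal to [u] stays in the supporting hyperplane, so its roots lie
    in [F]; the explicit multiples give the other inclusion. *)
Lemma roots_in_string d b : dot u d = 0 -> b \in roots_in Phi F ->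
  (forall x, x \in roots_in Phi F -> exists k : int, x = b + d *~ k) ->
  roots_in Phi F = root_string Phi d b.
Proof.
move=> ud bL Lstr; apply/fsetP => x; apply/idP/idP => [xL|].
  rewrite /root_string !inE; have [xP _] := (in_roots_in x).1 xL.
  by rewrite xP; apply/asboolP/Lstr.
move=> xS; apply/in_roots_in.
move: xS; rewrite /root_string !inE => /andP[xP /asboolP[k xE]]; split=> //.
have [_ ub] := (in_roots_in b).1 bL.
by rewrite xE -scaler_int !dotE ud mulr0 addr0.
Qed.

Hypothesis Phi_red : reduced Phi.
Hypothesis Phi_irr : irreducible dot Phi.

(** Stated for any ordered pair of roots whose segment covers [F], so that it applies to the two
    vertices in either order. *)
Lemma edge_roots g g' : 0 < c -> (forall a, a \in Phi -> dot u a <= c) ->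
  g \in roots_in Phi F -> g' \in roots_in Phi F -> g != g' ->
  (forall x, F x -> exists2 t : R, 0 <= t <= 1 & x = g' + t *: (g - g')) ->
  [/\ dot g g' <> 0, roots_in Phi F = [fset g; g']%fset & g - g' \in Phi] \/
  (dot g g' = 0 /\
   exists g'' : V,
     [/\ g'' <> g /\ g'' <> g',
         roots_in Phi F = [fset g; g'; g'']%fset,
         short_root dot Phi g'',
         g - g'' = g'' - g'
       & g - g'' \in Phi /\
         exists2 d : V, d \in Phi & g - g' = 2 *: d]).
Proof.
move=> c0 u_le gL g'L gNg' Fseg.
have [gP ug] := (in_roots_in g).1 gL.
have [g'P ug'] := (in_roots_in g').1 g'L.
have seg a : a \in Phi -> dot u a = c ->
    exists2 t : R, 0 <= t <= 1 & a = g' + t *: (g - g').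
  by move=> aP ua; apply: Fseg; apply/FP; split=> //; apply: sub_convex_hull.
have := edge_dot_ge0 rootsP c0 u_le gP g'P ug ug'.
rewrite le_eqVlt => /orP[/eqP/esym gg'|gg']; [right|left].
- have [x xP [ux xNg xNg']] :=
    edge_orthogonal_inner rootsP Phi_irr c0 u_le gP g'P ug ug' gg'.
  have [xshort gxE gxP Lx] := edge_orthogonal rootsP Phi_irr Phi_red c0 u_le
    gP g'P ug ug' seg gg' xP ux xNg xNg'.
  split=> //; exists x; split=> //; first by split; apply/eqP.
    apply/fsetP => a; rewrite !in_fsetU !in_fset1; apply/idP/idP => [/in_roots_in[aP ua]|].
      by have [->|->|->] := Lx a aP ua; rewrite eqxx ?orbT.
    by move=> /orP[/orP[]|] /eqP -> //; apply/in_roots_in.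
  split=> //; exists (g - x) => //.
  by rewrite scaler_nat mulr2n {2}gxE subrKA.
- have [dP Lgg'] := edge_acute rootsP Phi_red gP g'P gNg' seg gg'.
  split=> //; first by apply/eqP; rewrite gt_eqF.
  apply/fsetP => a; rewrite !in_fsetU !in_fset1; apply/idP/idP => [/in_roots_in[aP ua]|].
    by have [->|->] := Lgg' a aP ua; rewrite eqxx ?orbT.
  by move=> /orP[] /eqP ->.
Qed.

End EdgeRoots.

Unset Implicit Arguments.

Theorem corollary6p3 (R : realType) (V : vectType R) (dot : {dot V for idfun})
    (Phi : {fset V}) (F : set V) :
  crystallographic_root_system dot Phi ->
  reduced Phi ->
  irreducible dot Phi ->
  face dot (convex_hull Phi) F ->
  has_dim F 1 ->
  [/\ exists alpha beta : V,
        [/\ alpha \in Phi, beta \in roots_in Phi F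
          & roots_in Phi F = root_string Phi alpha beta],
      #|` roots_in Phi F |%fset = 2%N \/ #|` roots_in Phi F |%fset = 3%N,
      exists gamma gamma' : V,
        gamma <> gamma' /\ vertices dot F = [set gamma; gamma']
    & forall gamma gamma' : V, vertices dot F = [set gamma; gamma'] ->
        [/\ dot gamma gamma' <> 0,
            roots_in Phi F = [fset gamma; gamma']%fset
          & gamma - gamma' \in Phi]
        \/
        (dot gamma gamma' = 0 /\
         exists gamma'' : V,
           [/\ gamma'' <> gamma /\ gamma'' <> gamma',
               roots_in Phi F = [fset gamma; gamma'; gamma'']%fset,
               short_root dot Phi gamma'',
               gamma - gamma'' = gamma'' - gamma'
             & gamma - gamma'' \in Phi /\
               exists2 delta : V, delta \in Phi & gamma - gamma' = 2 *: delta])].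
Proof.
move=> rootsP Phi_red Phi_irr Fface Fdim.
have [u [c [g [g' [c0 u_le FP [gP g'P Fg Fg' gNg'] Fseg]]]]] :=
  face_segment rootsP Fface Fdim.
have ug : dot u g = c by have [] := (FP g).1 Fg.
have ug' : dot u g' = c by have [] := (FP g').1 Fg'.
have gL : g \in roots_in Phi F by apply/(in_roots_in FP).
have g'L : g' \in roots_in Phi F by apply/(in_roots_in FP).
have core := edge_roots rootsP FP Phi_red Phi_irr c0 u_le gL g'L gNg' Fseg.
have vE := segment_vertices dot gNg' Fg Fg' Fseg.
split; last 2 first.
- by exists g, g'; split=> //; apply/eqP.
- move=> x y; rewrite vE => xyE.
  have : [set g; g'] x by rewrite xyE; left.
  have : [set g; g'] y by rewrite xyE; right.
  have : [set x; y] g by rewrite -xyE; left.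
  have : [set x; y] g' by rewrite -xyE; right.
  move=> /= g'xy gxy yg xg.
  have [[-> ->]|[-> ->]] : (x = g /\ y = g') \/ (x = g' /\ y = g).
    by move/eqP: gNg'; case: g'xy gxy yg xg => [->|->] [->|->] [] ? [] ?;
       subst; tauto.
  + exact: core.
  + apply: (edge_roots rootsP FP) => //; first by rewrite eq_sym.
    move=> z /Fseg[t t01 ->]; exists (1 - t); first by lra.
    by rewrite scalerBl scale1r addrA subrKC -[g' - g]opprB scalerN opprK.
- case: core => [[_ LE dP]|[_ [x [[/eqP xg /eqP xg'] LE _ gxE [dP _]]]]].
  + exists (g - g'), g'; split=> //; apply: (roots_in_string FP) => //.
      by rewrite !dotE ug ug' subrr.
    move=> z; rewrite LE !inE => /orP[] /eqP ->.
      by exists 1; rewrite mulr1z subrKC.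
    by exists 0; rewrite mulr0z addr0.
  + have xL : x \in roots_in Phi F by rewrite LE !inE eqxx !orbT.
    have [_ ux] := (in_roots_in FP x).1 xL.
    (* Since [g - x = x - g'], the roots [g'], [x], [g] are the multiples 0, 1, 2 of this direction,
       counted from [g']. *)
    exists (g - x), g'; split=> //; apply: (roots_in_string FP) => //.
      by rewrite !dotE ug ux subrr.
    move=> z; rewrite LE !inE => /orP[/orP[]|] /eqP ->.
    * by exists 2; rewrite -[2]/(1 + 1) mulrzDr mulr1z {1}gxE addrA subrKC subrKC.
    * by exists 0; rewrite mulr0z addr0.
    * by exists 1; rewrite mulr1z gxE subrKC.
- case: core => [[_ -> _]|[_ [x [[/eqP xg /eqP xg'] -> _ _ _]]]]; [left|right].
    by rewrite cardfs2 gNg'.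
  by rewrite fsetUC cardfsU1 cardfs2 !inE negb_or xg xg' gNg'.
Qed.
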